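(* Let $n\ge 1$, $\alpha\in(0,1)$, let $\mathbf v\in\mathbb R^n$ with $\mathbf v\ge 0$ and $\mathbf 1_n^\top \mathbf v=1$, and let $R\in\mathbb R^{n\times n^2}$ with $R\ge 0$ and $\mathbf 1_n^\top R=\mathbf 1_{n^2}^\top$. Define $G(\mathbf x)=\alpha R(\mathbf x\otimes\mathbf x)+(1-\alpha)\mathbf v$ for $\mathbf x \in\mathbb R^n$. Consider the fixed-point iteration $\mathbf x_{k+1}=G(\mathbf x_k)$, $k=0,1,\dots$, started from $\mathbf x_0=0$. Then $0\le\mathbf x_k\le\mathbf x_{k+1}\le\mathbf 1_n$ for all $k\ge 0$, the limit $\mathbf m=\lim_{k\to\infty}\mathbf x_k$ exists, and $\mathbf m$ is the minimal nonnegative solution of the equation $\mathbf x=G(\mathbf x)$; that is, $\mathbf m\ge 0$, $\mathbf m=G(\mathbf m)$, and $\mathbf m\le\mathbf x$ for every $\mathbf x\ge 0$ with $\mathbf x=G(\mathbf x)$ (so such an $\mathbf m$ is unique).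
   Context: $\mathbf 1_k$ denotes the column vector of all ones of length $k$; inequalities between vectors and matrices are componentwise; $\otimes$ is the Kronecker product. *)

(* Defs.v *)
From mathcomp Require Export all_boot all_order all_algebra.
From mathcomp Require Export mxtens.
From mathcomp Require Export all_classical all_reals all_analysis.

Set Implicit Arguments.
Unset Strict Implicit.
Unset Printing Implicit Defensive.

Import Order.TTheory GRing.Theory Num.Theory.

Local Open Scope ring_scope.

Definition lemx (K : realType) (m n : nat) (A B : 'M[K]_(m, n)) : Prop :=
  forall i j, A i j <= B i j.

Notation "A <=m B" := (lemx A B) (at level 70, no associativity) : ring_scope.

(* [x *t x : 'M_(n * n, 1 * 1)] is a column vector because [1 * 1] is
   convertible to [1]; its entry of index [i * n + j] is [x i 0 * x j 0]. *)
Definition pagerank_map (K : realType) (n : nat) (alpha : K)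
    (R : 'M[K]_(n, n * n)) (v : 'cV[K]_n) (x : 'cV[K]_n) : 'cV[K]_n :=
  alpha *: (R *m (x *t x : 'cV[K]_(n * n))) + (1 - alpha) *: v.

Definition minimal_nonneg_fixpoint (K : realType) (n : nat)
    (G : 'cV[K]_n -> 'cV[K]_n) (m : 'cV[K]_n) : Prop :=
  [/\ 0 <=m m, m = G m & forall x : 'cV[K]_n, 0 <=m x -> x = G x -> m <=m x].

(* Main.v *)
Require Import Defs.

Set Implicit Arguments.
Unset Strict Implicit.
Unset Printing Implicit Defensive.

Import Order.TTheory GRing.Theory Num.Theory.
Import numFieldNormedType.Exports.

Local Open Scope classical_set_scope.
Local Open Scope ring_scope.

(** The map [G = pagerank_map alpha R v] is a polynomial map with nonnegative
    coefficients, hence continuous, and order preserving on the nonnegative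
    cone.  The statement is then Kleene's fixed point argument.  The orbit of
    [0] starts with [0 <= G 0], so it increases; if it is bounded it converges
    entry by entry, and continuity makes the limit a fixed point.  Any
    nonnegative fixed point [y] lies above [0], hence above [G 0], [G (G 0)]
    and so on, hence above the limit.

    The bound is where stochasticity enters.  Since the columns of [R] and the
    vector [v] sum to [1], the entry sum [s] of a vector evolves under [G] as
    [s |-> alpha * s ^+ 2 + (1 - alpha)], which maps the interval from [0] to
    [1] into itself.  The iterates thus have entry sum at most [1], and being
    nonnegative they have all their entries at most [1]. *)

(** * Entrywise order and convergence of matrices *)

Lemma lemx_trans (K : realType) (m n : nat) (A B C : 'M[K]_(m, n)) :
  A <=m B -> B <=m C -> A <=m C.
Proof. by move=> AB BC i j; exact: le_trans (AB i j) (BC i j). Qed.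

Lemma lemx_anti (K : realType) (m n : nat) (A B : 'M[K]_(m, n)) :
  A <=m B -> B <=m A -> A = B.
Proof. by move=> AB BA; apply/matrixP => i j; apply/le_anti; rewrite AB BA. Qed.

(** The neighbourhoods of a matrix are products of neighbourhoods of its
    finitely many entries, so entrywise convergence suffices. *)
Lemma cvg_mx (K : realType) (T : Type) (F : set_system T) {FF : Filter F}
    (m n : nat) (f : T -> 'M[K]_(m, n)) (l : 'M[K]_(m, n)) :
  (forall i j, f t i j @[t --> F] --> l i j) -> f @ F --> l.
Proof.
move=> fl A [P nbhsP PA]; apply: (filterS (fun t => PA (f t))).
by apply: filter_forall => i; apply: filter_forall => j; exact: fl (nbhsP i j).
Qed.

Lemma cvg_mx_entry (K : realType) (T : Type) (F : set_system T)
    {FF : Filter F} (m n : nat) (f : T -> 'M[K]_(m, n)) (l : 'M[K]_(m, n)) i j :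
  f @ F --> l -> f t i j @[t --> F] --> l i j.
Proof.
move=> fl.
exact: (@continuous_cvg _ _ _ F FF f (fun A : 'M[K]_(m, n) => A i j) l
          (@coord_continuous K m n i j l) fl).
Qed.

(** * Fixed points of monotone maps of the nonnegative cone *)

Section Kleene.
Variables (K : realType) (n : nat) (G : 'cV[K]_n -> 'cV[K]_n).
Hypothesis G0_ge0 : 0 <=m G 0.
Hypothesis G_mono : forall y z, 0 <=m y -> y <=m z -> G y <=m G z.
Variable x : nat -> 'cV[K]_n.
Hypothesis x_0 : x 0%N = 0.
Hypothesis x_S : forall k, x k.+1 = G (x k).

Lemma iterates_nondecreasing k : 0 <=m x k /\ x k <=m x k.+1.
Proof.
elim: k => [|k [x_ge0 x_le]]; first by rewrite x_S x_0; split => // i j.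
split; first exact: lemx_trans x_ge0 x_le.
by rewrite !x_S; apply: G_mono; rewrite -?x_S.
Qed.

Lemma iterates_le_fixpoint y : 0 <=m y -> y = G y -> forall k, x k <=m y.
Proof.
move=> y_ge0 yG; elim=> [|k IH]; first by rewrite x_0.
by rewrite x_S yG; apply: G_mono => //; have [] := iterates_nondecreasing k.
Qed.

Lemma iterates_cvg_minimal (b : 'cV[K]_n) :
  continuous G -> (forall k, x k <=m b) ->
  exists2 m, x @ \oo --> m & minimal_nonneg_fixpoint G m.
Proof.
move=> G_cont x_le_b.
have entry_nd i j : {homo (fun k => x k i j) : p q / (p <= q)%N >-> p <= q}.
  by apply/nondecreasing_seqP => k; have [_] := iterates_nondecreasing k.
have entry_cvg i j : cvgn (fun k => x k i j).
  apply: nondecreasing_is_cvgn => //.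
  by exists (b i j) => _ [k _ <-]; exact: x_le_b.
pose m : 'cV[K]_n := \matrix_(i, j) limn (fun k => x k i j).
have x_m : x @ \oo --> m.
  by apply: cvg_mx => i j; rewrite mxE; exact: entry_cvg.
exists m => //; split.
- move=> i j; have [x_ge0 _] := iterates_nondecreasing 0; rewrite [m i j]mxE.
  exact: le_trans (x_ge0 i j) (nondecreasing_cvgn_le (entry_nd i j) _ 0).
- (* The shifted orbit is both the orbit and its image under [G]. *)
  have xS_m : x k.+1 @[k --> \oo] --> m by rewrite (cvg_shiftS x).
  have xS_Gm : x k.+1 @[k --> \oo] --> G m.
    under eq_fun do rewrite x_S.
    by apply: continuous_cvg x_m; exact: G_cont.
  apply/matrixP => i j.
  exact: norm_cvg_unique (cvg_mx_entry xS_m) (cvg_mx_entry xS_Gm).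
- move=> y y_ge0 yG i j; rewrite mxE; apply: limr_le; first exact: entry_cvg.
  by apply: nearW => k; exact: iterates_le_fixpoint.
Qed.

End Kleene.

Lemma minimal_nonneg_fixpoint_unique (K : realType) (n : nat)
    (G : 'cV[K]_n -> 'cV[K]_n) (m m' : 'cV[K]_n) :
  minimal_nonneg_fixpoint G m -> minimal_nonneg_fixpoint G m' -> m' = m.
Proof.
move=> [m_ge0 mG m_min] [m'_ge0 m'G m'_min].
by apply: lemx_anti; [exact: m'_min | exact: m_min].
Qed.

(** * The PageRank map *)

Lemma pagerank_mapE (K : realType) (n : nat) (alpha : K)
    (R : 'M[K]_(n, n * n)) (v x : 'cV[K]_n) i j :
  pagerank_map alpha R v x i j =
  alpha * (\sum_p R i p * (x (mxtens_unindex p).1 0 *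
                           x (mxtens_unindex p).2 0))
  + (1 - alpha) * v i 0.
Proof.
rewrite /pagerank_map (ord1 j) !mxE; congr (_ * _ + _).
(* The column indices of the two factors live in ['I_1], hence are [0]. *)
by apply: eq_bigr => p _; rewrite mxE; congr (_ * (x _ _ * x _ _)); exact: ord1.
Qed.

Lemma pagerank_map_continuous (K : realType) (n : nat) (alpha : K)
    (R : 'M[K]_(n, n * n)) (v : 'cV[K]_n) :
  continuous (pagerank_map alpha R v).
Proof.
move=> x; apply: (@cvg_mx _ _ (nbhs x)) => i j; rewrite pagerank_mapE.
under eq_fun do rewrite pagerank_mapE.
apply: cvgD; last exact: cvg_cst.
apply: cvgM; first exact: cvg_cst.
apply: cvg_big => [|p _]; first exact: add_continuous.
apply: cvgM; first exact: cvg_cst.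
by apply: cvgM; exact: coord_continuous.
Qed.

Lemma ones_mulmxE (K : realType) (m n : nat) (A : 'M[K]_(m, n)) i j :
  ((const_mx 1 : 'cV[K]_m)^T *m A) i j = \sum_k A k j.
Proof. by rewrite mxE; apply: eq_bigr => k _; rewrite !mxE mul1r. Qed.

Section PageRank.
Variables (K : realType) (n : nat) (alpha : K).
Variables (v : 'cV[K]_n) (R : 'M[K]_(n, n * n)).
Hypotheses (alpha_ge0 : 0 <= alpha) (alpha_le1 : alpha <= 1).
Hypotheses (v_ge0 : 0 <=m v) (R_ge0 : 0 <=m R).

Lemma pagerank_map0_ge0 : 0 <=m pagerank_map alpha R v 0.
Proof.
move=> i j; rewrite pagerank_mapE big1 => [|p _]; last by rewrite mxE !mul0r mulr0.
have := v_ge0 i 0; rewrite !mxE mulr0 add0r => vi_ge0.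
by rewrite mulr_ge0 // subr_ge0.
Qed.

Lemma pagerank_map_mono (y z : 'cV[K]_n) :
  0 <=m y -> y <=m z -> pagerank_map alpha R v y <=m pagerank_map alpha R v z.
Proof.
move=> y_ge0 yz i j; rewrite !pagerank_mapE lerD2r ler_wpM2l // ler_sum // => p _.
have Rip_ge0 := R_ge0 i p; rewrite mxE in Rip_ge0.
have y_ge0' k : 0 <= y k 0 by have := y_ge0 k 0; rewrite mxE.
by rewrite ler_wpM2l // ler_pM.
Qed.

Hypothesis v_sum1 : (const_mx 1 : 'cV[K]_n)^T *m v = 1%:M.
Hypothesis R_stoch :
  (const_mx 1 : 'cV[K]_n)^T *m R = (const_mx 1 : 'cV[K]_(n * n))^T.

(** The columns of [R] sum to [1], so [R *m (x *t x)] has the same entry sum as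
    [x *t x], and the products of two entries of [x] add up to the square of
    the entry sum of [x]. *)
Lemma sum_pagerank_map (x : 'cV[K]_n) :
  \sum_i pagerank_map alpha R v x i 0 =
  alpha * (\sum_i x i 0) ^+ 2 + (1 - alpha).
Proof.
have v1 : \sum_i v i 0 = 1 by rewrite -(ones_mulmxE v 0 0) v_sum1 mxE eqxx.
have R1 p : \sum_i R i p = 1 by rewrite -(ones_mulmxE R 0 p) R_stoch !mxE.
under eq_bigr do rewrite pagerank_mapE.
rewrite big_split /= -!mulr_sumr v1 mulr1 exchange_big /= expr2 mulr_sum.
congr (_ * _ + _); apply: eq_bigr => p _.
by rewrite -mulr_suml R1 mul1r.
Qed.

Lemma sum_pagerank_map_le1 (x : 'cV[K]_n) :
  0 <=m x -> \sum_i x i 0 <= 1 -> \sum_i pagerank_map alpha R v x i 0 <= 1.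
Proof.
move=> x_ge0 x_le1; rewrite sum_pagerank_map addrC -lerBrDl subKr.
rewrite ler_piMr // expr_le1 // sumr_ge0 // => i _.
by have := x_ge0 i 0; rewrite mxE.
Qed.

End PageRank.

Lemma lemx_ones (K : realType) (n : nat) (x : 'cV[K]_n) :
  0 <=m x -> \sum_i x i 0 <= 1 -> x <=m const_mx 1.
Proof.
move=> x_ge0 x_le1 i j; rewrite (ord1 j) mxE; apply: le_trans x_le1.
rewrite (bigD1 i) //= lerDl sumr_ge0 // => k _.
by have := x_ge0 k 0; rewrite mxE.
Qed.

Theorem lemma1 (K : realType) (n : nat) (alpha : K) (v : 'cV[K]_n)
    (R : 'M[K]_(n, n * n)) (x : nat -> 'cV[K]_n)
    (n_ge1 : (1 <= n)%N)
    (alpha_gt0 : 0 < alpha) (alpha_lt1 : alpha < 1)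
    (v_ge0 : 0 <=m v) (v_sum1 : (const_mx 1 : 'cV[K]_n)^T *m v = 1%:M)
    (R_ge0 : 0 <=m R)
    (R_stoch : (const_mx 1 : 'cV[K]_n)^T *m R = (const_mx 1 : 'cV[K]_(n * n))^T)
    (x_0 : x 0%N = 0)
    (x_S : forall k : nat, x k.+1 = pagerank_map alpha R v (x k)) :
  (forall k : nat,
     [/\ 0 <=m x k, x k <=m x k.+1 & x k.+1 <=m (const_mx 1 : 'cV[K]_n)]) /\
  (exists m : 'cV[K]_n,
     [/\ x @ \oo --> m,
         minimal_nonneg_fixpoint (pagerank_map alpha R v) m
       & forall m' : 'cV[K]_n,
           minimal_nonneg_fixpoint (pagerank_map alpha R v) m' -> m' = m]).
Proof.
have alpha_ge0 := ltW alpha_gt0; have alpha_le1 := ltW alpha_lt1.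
have G0_ge0 : 0 <=m pagerank_map alpha R v 0 by exact: pagerank_map0_ge0.
have G_mono := pagerank_map_mono v alpha_ge0 R_ge0.
have x_nd := iterates_nondecreasing G0_ge0 G_mono x_0 x_S.
have x_ge0 k : 0 <=m x k by have [] := x_nd k.
have x_sum k : \sum_i x k i 0 <= 1.
  elim: k => [|k IH]; first by rewrite x_0 big1 // => i _; rewrite mxE.
  by rewrite x_S; apply: sum_pagerank_map_le1.
have x_le1 k : x k <=m const_mx 1 by exact: lemx_ones.
split; first by move=> k; have [] := x_nd k.
have [m x_m m_min] := iterates_cvg_minimal G0_ge0 G_mono x_0 x_S
  (@pagerank_map_continuous K n alpha R v) x_le1.
by exists m; split => // m'; exact: minimal_nonneg_fixpoint_unique.
Qed.
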